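(* Let $F:\mathcal{R}\times\mathcal{O}\to\mathcal{R}$ be the transition map of the runtime (with fixed parameters $\theta$), let $R_0=R_{\mathrm{init}}$ and $R_t=F(R_{t-1},o_t;\theta)$ for $1\le t\le T$ be the real trajectory, let $z$ be a target that first enters the observation stream at step $\tau\ge1$, and let $\{R^{-z}_t\}$ be the counterfactual trajectory. Then for all $0\le t\le\tau-1$, $R_t=R^{-z}_t$.
   Context: $\mathcal{R}$ is the set of runtime states and $\mathcal{O}$ the set of observations; each observation is a set of items. The observation stream is $o_1,\dots,o_T\in\mathcal{O}$ and $F$ is a deterministic function. The target $z$ satisfies $z\in o_\tau$ and $z\notin o_t$ for all $t<\tau$, where $1\le\tau\le T$. The counterfactual observation stream is $o^{-z}_t=o_t$ for $t\ne\tau$ and $o^{-z}_\tau=o_\tau\setminus\{z\}$. The counterfactual trajectory is $R^{-z}_0=R_{\mathrm{init}}$ and $R^{-z}_t=F(R^{-z}_{t-1},o^{-z}_t;\theta)$ for $1\le t\le T$. *)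

(* Defs.v *)
From mathcomp Require Import all_boot.
From mathcomp Require Import classical_sets.

Set Implicit Arguments.
Unset Strict Implicit.
Unset Printing Implicit Defensive.

Local Open Scope classical_set_scope.

(* Finite families indexed by 1..T (or 0..T) are represented by functions on
   nat of which only the values at 1..T (or 0..T) are ever constrained.
   Observations range over an arbitrary collection [Obs] of sets of items, used
   as a type; [val] maps an observation to its underlying set. *)

(* [z] need not be absent from [o 0], which is not part of the stream. *)
Definition first_enters (Item : Type) (Obs : set (set Item))
    (o : nat -> Obs) (z : Item) (tau : nat) : Prop :=
  val (o tau) z /\ forall t, 1 <= t < tau -> ~ val (o t) z.

(* A relation rather than a function of [o]: typing [oz] in [nat -> Obs] records
   that [o tau] deprived of [z] is again an observation, so [Obs] need not be
   closed under deletion of arbitrary items. *)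
Definition counterfactual_stream (Item : Type) (Obs : set (set Item))
    (T : nat) (o : nat -> Obs) (z : Item) (tau : nat) (oz : nat -> Obs) : Prop :=
  (forall t, 1 <= t <= T -> t <> tau -> oz t = o t) /\
  val (oz tau) = val (o tau) `\ z.

Definition trajectory (State O Theta : Type) (F : State -> O -> Theta -> State)
    (theta : Theta) (Rinit : State) (T : nat) (o : nat -> O)
    (R : nat -> State) : Prop :=
  R 0 = Rinit /\ forall t, 1 <= t <= T -> R t = F (R t.-1) (o t) theta.

(* Main.v *)
Require Import Defs.
From mathcomp Require Import all_boot.
From mathcomp Require Import classical_sets.

(** Within [1..T] the streams [o] and [oz] can differ only at [tau]. Before [tau], both trajectories
    therefore feed equal inputs to the same map [F] from the same [Rinit], and induction on the step
    gives equality. *)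

Theorem lemma1 (State Theta Item : Type) (Obs : set (set Item))
    (F : State -> Obs -> Theta -> State) (theta : Theta) (Rinit : State)
    (T : nat) (o : nat -> Obs) (z : Item) (tau : nat)
    (htau : 1 <= tau <= T)
    (hz : first_enters o z tau)
    (oz : nat -> Obs) (hoz : counterfactual_stream T o z tau oz)
    (R Rz : nat -> State)
    (hR : trajectory F theta Rinit T o R)
    (hRz : trajectory F theta Rinit T oz Rz) :
  forall t : nat, 0 <= t <= tau.-1 -> R t = Rz t.
Proof.
case/andP: htau => _ leT; case: hoz => ozE _; case: hR => R0 RS; case: hRz => Rz0 RzS.
elim=> [|t IHt] /=; first by rewrite R0 Rz0.
move=> lt_t_pred.
(* The input consumed in reaching state [t.+1] is [o t.+1], so the strict bound is what keeps this
   step clear of the deletion. *)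
have lt_t_tau : t.+1 < tau by rewrite -ltn_predRL.
have lt_t_T : 1 <= t.+1 <= T by rewrite /= (leq_trans (ltnW lt_t_tau)).
rewrite RS // RzS //= IHt /= ?(ltnW lt_t_pred) // ozE //.
by move=> eq_t; rewrite eq_t ltnn in lt_t_tau.
Qed.
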